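(* Let $X_1\in B_m$ and $X_2\in B_n$, and let $X=X_1\,\mathrm{sh}_m(X_2)\in B_{m+n}$. Then $X$ is strongly quasipositive if and only if both $X_1$ and $X_2$ are strongly quasipositive.
   Context: $B_n$ is the braid group on $n$ strings with Artin generators $\sigma_1,\dots,\sigma_{n-1}$. The shift homomorphism $\mathrm{sh}_m:B_n\to B_{m+n}$ is defined on generators by $\sigma_k\mapsto\sigma_{m+k}$; $B_m$ is viewed as a subgroup of $B_{m+n}$ via $\sigma_k\mapsto\sigma_k$. For $j\le k$ put $\tau_{k,j}=\sigma_k\sigma_{k-1}\cdots\sigma_j$ and $\sigma_{j,k+1}=\tau_{k,j}\sigma_j\tau_{k,j}^{-1}$ (band generators of the relevant braid group); a braid is strongly quasipositive if it is a product of band generators. *)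

(* Defs.v *)
From mathcomp Require Import all_boot.
Set Implicit Arguments. Unset Strict Implicit. Unset Printing Implicit Defensive.

(* Braid words: a letter (i, true) is sigma_i, (i, false) is sigma_i^{-1}. *)
Definition bword := seq (nat * bool).

Definition valid_word (n : nat) (w : bword) : bool :=
  all (fun l : nat * bool => (0 < l.1) && (l.1 < n)) w.

Definition inv_word (w : bword) : bword := rev [seq (l.1, ~~ l.2) | l <- w].

Inductive braid_eq (n : nat) : bword -> bword -> Prop :=
| beq_refl w : braid_eq n w w
| beq_sym u v : braid_eq n u v -> braid_eq n v u
| beq_trans u v w : braid_eq n u v -> braid_eq n v w -> braid_eq n u w
| beq_cat u u' v v' : braid_eq n u u' -> braid_eq n v v' ->
    braid_eq n (u ++ v) (u' ++ v')
| beq_cancel i b : 0 < i -> i < n -> braid_eq n [:: (i, b); (i, ~~ b)] [::]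
| beq_comm i j : 0 < i -> i.+1 < j -> j < n ->
    braid_eq n [:: (i, true); (j, true)] [:: (j, true); (i, true)]
| beq_braid i : 0 < i -> i.+1 < n ->
    braid_eq n [:: (i, true); (i.+1, true); (i, true)]
               [:: (i.+1, true); (i, true); (i.+1, true)].

Definition shift_word (m : nat) (w : bword) : bword :=
  [seq (m + l.1, l.2) | l <- w].

Definition tau_word (k j : nat) : bword :=
  [seq (i, true) | i <- rev (iota j (k.+1 - j))].

(* band generator sigma_{j,k+1} = tau_{k,j} sigma_j tau_{k,j}^{-1} *)
Definition band_word (j k : nat) : bword :=
  tau_word k j ++ (j, true) :: inv_word (tau_word k j).

Definition band_ok (n : nat) (p : nat * nat) : bool :=
  [&& 0 < p.1, p.1 <= p.2 & p.2 < n].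

Definition strongly_quasipositive (n : nat) (w : bword) : Prop :=
  exists bs : seq (nat * nat),
    all (band_ok n) bs /\
    braid_eq n (flatten [seq band_word p.1 p.2 | p <- bs]) w.

(* Main.v *)
(** Let the braid group act on the free product of copies of Z/2 with
    generators [x_1, x_2, ...] by the Hurwitz-type automorphisms
    [sigma_i : x_i |-> x_{i+1}, x_{i+1} |-> x_{i+1} x_i x_{i+1}].  The element
    [x_m ... x_1] is fixed by every [sigma_i] with [i <> m], while [sigma_m]
    moves it into the set of elements whose reduced word starts with some [x_k],
    [k > m]; that set is stable under [sigma_m] and under every [sigma_i] and
    its inverse for [i <> m].  A band generator joining a strand [<= m] to a
    strand [> m] is conjugate to [sigma_m] by letters different from [sigma_m],
    so a product of band generators which lies in [B_m * sh_m (B_n)] uses no such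
    generator.  Forgetting all strands but the first [m] (or but the last [n])
    is compatible with the braid relations and takes such a product to the
    product of its bands in [B_m] (or [B_n]), and [X] to [X_1] (or [X_2]). *)

Require Import Defs.
From mathcomp Require Import all_boot.
From mathcomp Require Import zify.
Set Implicit Arguments. Unset Strict Implicit. Unset Printing Implicit Defensive.

(** * Reduced words in the free product of copies of Z/2 *)

(* A word [k_1; ...; k_r] stands for the product of the involutions x_{k_1} ... x_{k_r};
   [push k w] is left multiplication of a reduced word by x_k. *)
Definition push (k : nat) (w : seq nat) : seq nat :=
  if w is k' :: w' then if k == k' then w' else k :: w else [:: k].

Definition reduce (w : seq nat) : seq nat := foldr push [::] w.

Definition reduced (w : seq nat) : bool := sorted (fun x y => x != y) w.

Lemma push_reduced k w : reduced w -> reduced (push k w).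
Proof.
case: w => [|k' w] //= pw; case: eqP => [_|/eqP nk]; first exact: path_sorted pw.
by rewrite /= nk.
Qed.

Lemma pushK k w : reduced w -> push k (push k w) = w.
Proof.
case: w => [_|k' w] /=; first by rewrite eqxx.
case: (eqVneq k k') => [<-|nk] /=; last by rewrite eqxx.
by case: w => [|k'' w] //= /andP [/negPf -> _].
Qed.

Lemma reduce_reduced w : reduced (reduce w).
Proof. by elim: w => //= k w; apply: push_reduced. Qed.

Lemma reduce_id w : reduced w -> reduce w = w.
Proof.
elim: w => //= k w IH pw; rewrite IH; last exact: path_sorted pw.
by case: w pw {IH} => //= k' w /andP [/negPf ->].
Qed.

Lemma reduce_cat u v : reduce (u ++ v) = foldr push (reduce v) u.
Proof. by rewrite /reduce foldr_cat. Qed.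

Lemma eq_reduce_catl u v v' :
  reduce v = reduce v' -> reduce (u ++ v) = reduce (u ++ v').
Proof. by rewrite !reduce_cat => ->. Qed.

Lemma reduce_catr u v : reduce (reduce u ++ v) = reduce (u ++ v).
Proof.
elim: u => //= k u <-; case: (reduce u) => [|k' w] //=.
by case: eqP => [->|_] //=; rewrite pushK ?reduce_reduced.
Qed.

Lemma eq_reduce_catr u u' v :
  reduce u = reduce u' -> reduce (u ++ v) = reduce (u' ++ v).
Proof. by move=> e; rewrite -reduce_catr e reduce_catr. Qed.

(** * Substitutions and the Hurwitz automorphisms *)

Definition subst (f : nat -> seq nat) (w : seq nat) : seq nat :=
  flatten (map f w).

Lemma subst_cat f u v : subst f (u ++ v) = subst f u ++ subst f v.
Proof. by rewrite /subst map_cat flatten_cat. Qed.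

(** A substitution by involutions is well defined on the free product: cancelling a pair [k; k]
    removes only [f k ++ f k] from the image. *)
Lemma subst_reduce f w :
  (forall k, reduce (f k ++ f k) = [::]) ->
  reduce (subst f (reduce w)) = reduce (subst f w).
Proof.
move=> ff; elim: w => //= k w IH; rewrite /subst /= -/(subst f w).
rewrite -(eq_reduce_catl _ IH).
case: (reduce w) => [|k' u] //=; case: eqP => [->|_] //.
by rewrite /subst /= catA -reduce_catr ff.
Qed.

(** Exchanging [a] and [b] gives the inverse automorphism, so one formula serves for both signs of a
    braid letter. *)
Definition hurwitz (a b k : nat) : seq nat :=
  if k == a then [:: b] else if k == b then [:: b; a; b] else [:: k].

Lemma hurwitz_inv a b k : reduce (hurwitz a b k ++ hurwitz a b k) = [::].
Proof.
rewrite /hurwitz; case: eqP => _; first by rewrite /= eqxx.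
case: eqP => _; last by rewrite /= eqxx.
rewrite -[reduce _]/(push b (push a (push b (push b (push a (push b [::])))))).
by rewrite !pushK ?push_reduced.
Qed.

(* Only the first letter of the image matters later; the second letter is recorded to make
   the induction on [g] go through. *)
Lemma reduce_hurwitz_shape (a b : nat) (g : seq nat) : a != b -> reduced g ->
  let V := reduce (subst (hurwitz a b) g) in
  match g with
  | [::] => V = [::]
  | k :: _ =>
    if k == b then exists V', V = b :: a :: V'
    else if k == a then
      (exists V', V = a :: V') \/
      (exists2 V', V = b :: V' & forall x V'', V' = x :: V'' -> (x != a) && (x != b))
    else exists V', V = k :: V'
  end.
Proof.
move=> nab; have nba : b == a = false by rewrite eq_sym (negPf nab).
elim: g => //= k g IH pg.
have {IH} := IH (path_sorted pg).
rewrite /subst /= -/(subst _ g) reduce_cat.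
move: (reduce (subst _ g)) => V; rewrite /hurwitz; move: pg.
have [->|nkb] := eqVneq k b; first rewrite nba.
  case: g => [|x g] /=.
    by move=> _ ->; exists [:: b]; rewrite /= (negPf nab) /= nba.
  case/andP => nbx _; rewrite [x == b]eq_sym (negPf nbx).
  have [_|nxa] := eqVneq x a.
    case=> [[V' ->]|[V' -> hV']].
      by exists (b :: a :: V'); rewrite /= nba /= (negPf nab) /= nba.
    (* The last [b] of [b; a; b] cancels against the head of [b :: V']; the condition on [V'] then
       stops any further cancellation. *)
    rewrite /= eqxx; exists V'; case: V' hV' => [|y V'] hV' /=; first by rewrite nba.
    by have /andP[nya nyb] := hV' _ _ erefl; rewrite eq_sym (negPf nya) /= nba.
  by case=> V' ->; exists [:: b, x & V']; rewrite /= (negPf nbx) /= (negPf nab) /= nba.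
have [ka|nka] := eqVneq k a.
  case: g => [|x g] /=.
    by move=> _ ->; right; exists [::].
  rewrite ka => /andP [nax _].
  have [_|nxb] := eqVneq x b.
    by case=> V' ->; left; exists V'; rewrite /= eqxx.
  rewrite eq_sym (negPf nax); case=> V' ->; right; exists (x :: V').
    by rewrite /= eq_sym (negPf nxb).
  by move=> _ _ [<- _]; rewrite eq_sym nax nxb.
case: g => [|x g] /=.
    by move=> _ ->; exists [::].
case/andP => nkx _.
have [_|nxb] := eqVneq x b.
  by case=> V' ->; exists [:: b, a & V']; rewrite /= (negPf nkb).
have [_|nxa] := eqVneq x a.
  case=> [[V' ->]|[V' -> _]] /=; rewrite ?(negPf nkb) ?(negPf nka); last by exists (b :: V').
  by exists (a :: V').
by case=> V' -> /=; rewrite (negPf nkx); exists (x :: V').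
Qed.

(** * The action of the braid group *)

Definition artin (l : nat * bool) : nat -> seq nat :=
  if l.2 then hurwitz l.1 l.1.+1 else hurwitz l.1.+1 l.1.

Definition act (u : bword) (g : seq nat) : seq nat :=
  foldr (fun l => subst (artin l)) g u.

Lemma artin_inv l k : reduce (artin l k ++ artin l k) = [::].
Proof. by rewrite /artin; case: l.2; apply: hurwitz_inv. Qed.

Lemma act_catl u v g : act (u ++ v) g = act u (act v g).
Proof. exact: foldr_cat. Qed.

Lemma act_catr u g h : act u (g ++ h) = act u g ++ act u h.
Proof. by elim: u => //= l u ->; rewrite subst_cat. Qed.

Lemma act_nil u : act u [::] = [::].
Proof. by elim: u => //= l u ->. Qed.

Lemma eq_reduce_act u g h :
  reduce g = reduce h -> reduce (act u g) = reduce (act u h).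
Proof.
move=> e; elim: u => //= l u IH.
by rewrite -(subst_reduce _ (artin_inv l)) IH (subst_reduce _ (artin_inv l)).
Qed.

Lemma act_ext u v : (forall k, reduce (act u [:: k]) = reduce (act v [:: k])) ->
  forall g, reduce (act u g) = reduce (act v g).
Proof.
move=> e; elim=> [|k g IH]; first by rewrite !act_nil.
rewrite -cat1s !act_catr (eq_reduce_catl _ IH); exact: eq_reduce_catr.
Qed.

Ltac decide_eqs :=
  repeat first [progress simpl | progress rewrite eqxx |
    match goal with |- context [@eq_op ?T ?x ?y] =>
      first [rewrite (_ : @eq_op T x y = false); last lia
            |rewrite (_ : @eq_op T x y = true); last lia] end].

Lemma hurwitzK (a b k : nat) : a != b ->
  reduce (subst (hurwitz b a) (hurwitz a b k)) = [:: k].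
Proof.
rewrite /subst /hurwitz => nab.
have [->|nka] := eqVneq k a; first by decide_eqs.
have [->|nkb] := eqVneq k b; first by decide_eqs.
by decide_eqs.
Qed.

(** By [act_ext] each relation need only be checked on the generators, and there only those with an
    index moved by the letters matter. *)
Lemma act_braid_eq N u v g :
  braid_eq N u v -> reduce (act u g) = reduce (act v g).
Proof.
move=> e; elim: e g => {u v} //.
- by move=> u v w _ IH1 _ IH2 g; rewrite IH1.
- move=> u u' v v' _ IH1 _ IH2 g; rewrite !act_catl IH1.
  exact: eq_reduce_act.
- move=> i b _ _; apply: act_ext => k /=; rewrite {2}/subst /= cats0.
  by case: b; apply: hurwitzK => /=; lia.
- move=> i j _ lij _; apply: act_ext => k; rewrite /= /subst /= !cats0 /artin /= /hurwitz.
  have [ek|nk1] := eqVneq k i; first by subst k; decide_eqs.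
  have [ek|nk2] := eqVneq k i.+1; first by subst k; decide_eqs.
  have [ek|nk3] := eqVneq k j; first by subst k; decide_eqs.
  have [ek|nk4] := eqVneq k j.+1; first by subst k; decide_eqs.
  by decide_eqs.
- move=> i _ _; apply: act_ext => k; rewrite /= /subst /= !cats0 /artin /= /hurwitz.
  have [ek|nk1] := eqVneq k i; first by subst k; decide_eqs.
  have [ek|nk2] := eqVneq k i.+1; first by subst k; decide_eqs.
  have [ek|nk3] := eqVneq k i.+2; first by subst k; decide_eqs.
  by decide_eqs.
Qed.

(** * Leading letters and the image of the wall *)

Lemma head_reduce_hurwitz (a b : nat) (g : seq nat) :
  0 < a -> 0 < b -> a != b ->
  let x := head 0 (reduce g) in
  let y := head 0 (reduce (subst (hurwitz a b) g)) in
  if x == a then (y == a) || (y == b) else y == x.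
Proof.
move=> a0 b0 nab.
have := reduce_hurwitz_shape nab (reduce_reduced g).
rewrite subst_reduce; last exact: hurwitz_inv.
(* Since [a] is positive, the default head 0 of the empty word is not mistaken for the letter
   [a]. *)
case: (reduce g) => [|k w] /=; first by move->; case: eqP a0 => [<-|].
have [->|nkb] := eqVneq k b; first by rewrite eq_sym (negPf nab) => -[V' ->].
have [ka|nka] := eqVneq k a.
  by case=> [[V' ->]|[V' -> _]] /=; rewrite eqxx ?orbT.
by case=> V' ->.
Qed.

(* [head 0] of the empty word is 0, so [m < head 0 w] includes that [w] is not empty. *)
Lemma head_reduce_artin m l g : 0 < l.1 -> (l.1 == m) ==> l.2 ->
  m < head 0 (reduce g) -> m < head 0 (reduce (subst (artin l) g)).
Proof.
case: l => i [] /= i0 im hg; rewrite /artin /=.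
- have := @head_reduce_hurwitz i i.+1 g i0 isT _; cbv zeta.
  move: hg; move: (head 0 _) (head 0 _) => x y hx /(_ ltac:(lia)).
  by case: eqP => [xi|_]; lia.
(* The inverse letter may lower a leading [i.+1] to [i], which leaves the range above [m] only if
   [i = m]; the sign condition excludes this. *)
- have := @head_reduce_hurwitz i.+1 i g isT i0 _; cbv zeta.
  move: hg; move: (head 0 _) (head 0 _) => x y hx /(_ ltac:(lia)).
  by case: eqP => [xi|_]; lia.
Qed.

(** This corresponds to the loop around the first [m] punctures of the disc, which braids not mixing
    these punctures with the others preserve. *)
Definition wall (m : nat) : seq nat := rev (iota 1 m).

Lemma wallS m : wall m.+1 = m.+1 :: wall m.
Proof. by rewrite /wall -[in LHS](addn1 m) iotaD rev_cat. Qed.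

Lemma reduce_wall m : reduce (wall m) = wall m.
Proof.
apply: reduce_id; elim: m => // -[|m] //; rewrite !wallS => pw /=.
by apply/andP; split; [lia | exact: pw].
Qed.

Lemma subst_artin_wall l m : m < l.1 -> subst (artin l) (wall m) = wall m.
Proof.
case: l => i b /=; elim: m => // m IH mi.
rewrite wallS /subst /= -/(subst _ _) IH; last exact: ltnW.
rewrite -[RHS]cat1s; congr (_ ++ _); rewrite /artin /= /hurwitz.
by case: b {IH}; decide_eqs.
Qed.

(** For an index [i > m] the wall contains neither moved letter. For [i < m] it contains
    [x_{i+1} x_i], which sigma_i sends to [x_{i+1} x_i x_{i+1} x_{i+1} = x_{i+1} x_i], and similarly
    for the inverse. *)
Lemma reduce_artin_wall l m : 0 < l.1 -> l.1 != m ->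
  reduce (subst (artin l) (wall m)) = wall m.
Proof.
move=> l0 lm; rewrite -[RHS]reduce_wall.
have [ml|] := ltnP m l.1; first by rewrite subst_artin_wall.
rewrite leq_eqVlt (negPf lm) /=; elim: m {lm} => // m IH.
rewrite ltnS leq_eqVlt => /orP[/eqP lm|lm]; last first.
  rewrite wallS /subst /= -/(subst _ _) reduce_cat (IH lm) -reduce_cat.
  rewrite -[RHS]/(reduce ([:: m.+1] ++ _)).
  congr (reduce (_ ++ _)); case: l l0 {IH} lm => i b /= l0 lm.
  by rewrite /artin /= /hurwitz; case: b; decide_eqs.
case: m lm {IH} l0 => [->//|m] lm _.
rewrite !wallS -[_ :: _ :: _]/([:: m.+2; m.+1] ++ wall m) subst_cat.
rewrite subst_artin_wall; last by rewrite lm.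
rewrite !reduce_cat; move: (reduce_reduced (wall m)).
move: (reduce (wall m)) => w pw; case: l lm => _ b /= ->.
rewrite /artin /= /subst /hurwitz /=; case: b; decide_eqs.
  by rewrite pushK // push_reduced.
by rewrite (pushK m.+1) // !push_reduced.
Qed.

(** The leading [x_m] becomes [x_{m+1}], and nothing cancels because the rest of the wall has only
    smaller letters. *)
Lemma head_artin_wall m : 0 < m ->
  m < head 0 (reduce (subst (artin (m, true)) (wall m))).
Proof.
case: m => // m _; rewrite wallS /subst /= -/(subst _ _) subst_artin_wall //.
rewrite /artin /hurwitz /= eqxx /= reduce_wall.
case: m => [//|m]; rewrite wallS /=; decide_eqs; lia.
Qed.

(** Letters act from the right end of [u]. The wall stays fixed up to the first sigma_m met; from
    then on the leading letter exceeds [m] and no later letter undoes this. *)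
Lemma act_positive m u : 0 < m ->
  all (fun l : nat * bool => (0 < l.1) && ((l.1 == m) ==> l.2)) u ->
  if has (fun l : nat * bool => l.1 == m) u
  then is_true (m < head 0 (reduce (act u (wall m))))
  else reduce (act u (wall m)) = wall m.
Proof.
move=> m0; elim: u => [_|l u IH] /=; first exact: reduce_wall.
case/andP => /andP[l0 lm] /IH {IH}; case: (has _ u) => IH.
  by rewrite orbT; apply: head_reduce_artin.
rewrite orbF -subst_reduce ?IH; last exact: artin_inv.
case: eqP lm => [|/eqP nlm _]; last exact: reduce_artin_wall.
by case: l l0 => i b /= _ -> /= ->; apply: head_artin_wall.
Qed.

(** * Band generators as conjugates of a crossing letter *)

Lemma braid_eq_ctx N p u v q :
  braid_eq N u v -> braid_eq N (p ++ u ++ q) (p ++ v ++ q).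
Proof. by move=> e; do ![apply: beq_cat => //; try exact: beq_refl]. Qed.

Lemma braid_eq_comm N i j b c : 0 < i -> i.+1 < j -> j < N ->
  braid_eq N [:: (i, b); (j, c)] [:: (j, c); (i, b)].
Proof.
(* Far commutation is given for positive letters only; conjugating by a letter carries it over to
   the inverse. *)
have inv_comm k x y : 0 < k -> k < N ->
    braid_eq N [:: (k, x); y] [:: y; (k, x)] ->
    braid_eq N [:: (k, ~~ x); y] [:: y; (k, ~~ x)].
  move=> k0 kN e; have cancel z : braid_eq N [:: (k, z); (k, ~~ z)] [::].
    exact: beq_cancel.
  apply: (beq_trans (v := [:: (k, ~~ x); y; (k, x); (k, ~~ x)])).
    exact: (braid_eq_ctx [:: _; _] [::] (beq_sym (cancel x))).
  apply: (beq_trans (v := [:: (k, ~~ x); (k, x); y; (k, ~~ x)])).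
    exact: (braid_eq_ctx [:: _] [:: _] (beq_sym e)).
  have cancel' : braid_eq N [:: (k, ~~ x); (k, x)] [::].
    by have := cancel (~~ x); rewrite negbK.
  exact: (braid_eq_ctx [::] [:: _; _] cancel').
move=> i0 ij jN; have iN : i < N by lia.
have step c' : braid_eq N [:: (i, true); (j, c')] [:: (j, c'); (i, true)].
  case: c'; first exact: beq_comm.
  apply: beq_sym; apply: (inv_comm j true); [lia | done |].
  exact: beq_sym (beq_comm i0 ij jN).
by case: b => //; apply: (inv_comm i true).
Qed.

Lemma band_wordS j k : j <= k.+1 ->
  band_word j k.+1 = (k.+1, true) :: band_word j k ++ [:: (k.+1, false)].
Proof.
move=> jk; rewrite /band_word.
have -> : tau_word k.+1 j = (k.+1, true) :: tau_word k j.
  by rewrite /tau_word subSn // -(addn1 (k.+1 - j)) iotaD rev_cat /= subnKC.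
by rewrite /inv_word /= rev_cons -cats1 -catA.
Qed.

Lemma braid_eq_band_diag N j : 0 < j -> j < N ->
  braid_eq N (band_word j j) [:: (j, true)].
Proof.
move=> j0 jN; rewrite /band_word /tau_word subSnn /=.
exact: (braid_eq_ctx [:: _] [::] (beq_cancel true j0 jN)).
Qed.

(** A band can also be unwound from its lower end. For [k = j.+1] this is the braid relation; for
    larger [k] the outer letters commute with sigma_j. *)
Lemma braid_eq_band_conj N j k : 0 < j -> j < k -> k < N ->
  braid_eq N (band_word j k) ((j, false) :: band_word j.+1 k ++ [:: (j, true)]).
Proof.
move=> j0; elim: k => // k IH; rewrite ltnS leq_eqVlt => /orP[/eqP <-|jk] kN.
  have jN : j < N by exact: ltnW.
  rewrite band_wordS //.
  apply: (beq_trans (v := [:: (j.+1, true); (j, true); (j.+1, false)])).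
    exact: (braid_eq_ctx [:: _] [:: _] (braid_eq_band_diag j0 jN)).
  apply: (beq_trans (v := [:: (j, false); (j.+1, true); (j, true)])); last first.
    apply: (braid_eq_ctx [:: _] [:: _] (u := [:: _])).
    exact/beq_sym/braid_eq_band_diag.
  apply: (beq_trans (v := [:: (j, false); (j, true); (j.+1, true); (j, true); (j.+1, false)])).
    exact: (braid_eq_ctx [::] [:: _; _; _] (beq_sym (beq_cancel false j0 jN))).
  apply: (beq_trans (v :=
    [:: (j, false); (j.+1, true); (j, true); (j.+1, true); (j.+1, false)])).
    exact: (braid_eq_ctx [:: _] [:: _] (beq_braid j0 kN)).
  exact: (braid_eq_ctx [:: _; _; _] [::] (beq_cancel true (ltn0Sn j) kN)).
have comm b c : braid_eq N [:: (j, b); (k.+1, c)] [:: (k.+1, c); (j, b)].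
  exact: braid_eq_comm.
rewrite !band_wordS; try lia.
set w := band_word j.+1 k.
apply: (beq_trans (v := [:: (k.+1, true); (j, false)] ++ w ++ [:: (j, true); (k.+1, false)])).
  have := braid_eq_ctx [:: (k.+1, true)] [:: (k.+1, false)] (IH jk (ltnW kN)).
  by rewrite /= -catA.
apply: (beq_trans (v := [:: (j, false); (k.+1, true)] ++ w ++ [:: (j, true); (k.+1, false)])).
  exact: (braid_eq_ctx [::] _ (beq_sym (comm false true))).
have := braid_eq_ctx ([:: (j, false); (k.+1, true)] ++ w) [::] (comm true false).
by rewrite !cats0 /= -!catA.
Qed.

(** Letters above [m] are peeled off by [band_wordS], then letters below [m] by
    [braid_eq_band_conj], until sigma_m alone remains. *)
Lemma braid_eq_band_crossing N m j k :
  0 < j -> j <= m -> m <= k -> k < N ->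
  exists p q, all (fun l : nat * bool => (0 < l.1) && (l.1 != m)) (p ++ q) /\
    braid_eq N (band_word j k) (p ++ (m, true) :: q).
Proof.
move=> j0 jm mk; elim: k mk => [|k IH].
  by rewrite leqn0 => /eqP m0; move: jm j0; rewrite m0; case: j.
rewrite leq_eqVlt => /orP[/eqP mk|mk] kN; last first.
  have [p [q [pq e]]] := IH mk (ltnW kN).
  exists ((k.+1, true) :: p), (q ++ [:: (k.+1, false)]); split.
    by move: pq; rewrite /= !all_cat /= => /andP[-> ->] /=; lia.
  rewrite band_wordS; last by lia.
  by have := braid_eq_ctx [:: (k.+1, true)] [:: (k.+1, false)] e; rewrite /= -catA.
rewrite -mk in kN *; move: {2}(m - j) (erefl (m - j)) => d.
elim: d j j0 jm {IH mk k} => [|d IH] j j0 jm ed.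
  have -> : j = m by lia.
  by exists [::], [::]; split=> //; apply: braid_eq_band_diag; lia.
have [||p [q [pq e]]] := IH j.+1 isT; [lia|lia|].
exists ((j, false) :: p), (q ++ [:: (j, true)]); split.
  by move: pq; rewrite /= !all_cat /= => /andP[-> ->] /=; lia.
apply: (beq_trans (braid_eq_band_conj j0 _ kN)); first by lia.
by have := braid_eq_ctx [:: (j, false)] [:: (j, true)] e; rewrite /= -catA.
Qed.

Lemma all_band_word (j k : nat) :
  j <= k -> all (fun l : nat * bool => j <= l.1 <= k) (band_word j k).
Proof.
move=> jk; have tau : all (fun l : nat * bool => j <= l.1 <= k) (tau_word k j).
  by apply/allP => _ /mapP[i + ->]; rewrite mem_rev mem_iota /=; lia.
rewrite /band_word all_cat /= tau leqnn jk /= /inv_word all_rev all_map.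
exact: tau.
Qed.

(** A band word across [m] itself contains the inverse of sigma_m; this rewriting brings the product
    into the form that [act_positive] requires. *)
Lemma bands_positive N m bs : all (band_ok N) bs ->
  exists u, [/\ braid_eq N (flatten [seq band_word p.1 p.2 | p <- bs]) u,
    all (fun l : nat * bool => (0 < l.1) && ((l.1 == m) ==> l.2)) u &
    has (fun l : nat * bool => l.1 == m) u = has (fun p => p.1 <= m <= p.2) bs].
Proof.
elim: bs => [_|[j k] bs IH /=]; first by exists [::]; split=> //; apply: beq_refl.
case/andP => /and3P[/= j0 jk kN] /IH [u [e pu hu]].
have [/andP[jm mk]|njk] := boolP (j <= m <= k).
  have [p [q [pq e']]] := braid_eq_band_crossing j0 jm mk kN.
  have pos v : all (fun l : nat * bool => (0 < l.1) && (l.1 != m)) v ->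
      all (fun l : nat * bool => (0 < l.1) && ((l.1 == m) ==> l.2)) v.
    by apply: sub_all => l /andP[-> /negPf ->].
  move: pq; rewrite all_cat => /andP[/pos pp /pos pq].
  exists ((p ++ (m, true) :: q) ++ u); split; first exact: beq_cat.
    by rewrite !all_cat /= pp pq pu eqxx /=; lia.
  by rewrite !has_cat /= eqxx !orbT.
exists (band_word j k ++ u); have ab := all_band_word jk; split.
- by apply: beq_cat => //; apply: beq_refl.
- rewrite all_cat pu andbT; apply: sub_all ab => l jlk.
  by case: eqP => [lm|_]; [move: njk jlk; rewrite lm => /negPf -> | lia].
- rewrite has_cat hu; case: hasP => // -[l /(allP ab) jlk /eqP lm].
  by move: jlk njk; rewrite lm => ->.
Qed.

(** The two words act alike on [wall m]: [X] fixes it, whose head is [m], while a crossing band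
    would yield a head above [m]. *)
Lemma bands_not_crossing N m bs X : all (band_ok N) bs ->
  all (fun l : nat * bool => (0 < l.1) && (l.1 != m)) X ->
  braid_eq N (flatten [seq band_word p.1 p.2 | p <- bs]) X ->
  ~~ has (fun p => p.1 <= m <= p.2) bs.
Proof.
move=> okbs okX e; have [u [eu pu <-]] := bands_positive m okbs.
case: (posnP m) => [m0|m0].
  by apply/hasPn => l /(allP pu) /andP[l0 _]; rewrite m0; lia.
apply/negP => hu; have := act_positive m0 pu; rewrite hu.
rewrite (act_braid_eq _ (beq_trans (beq_sym eu) e)).
have posX : all (fun l : nat * bool => (0 < l.1) && ((l.1 == m) ==> l.2)) X.
  by apply: sub_all okX => l /andP[-> /negPf ->].
have := act_positive m0 posX.
have -> : has (fun l : nat * bool => l.1 == m) X = false.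
  by apply/hasPn => l /(allP okX) /andP[].
by move->; case: m m0 {e eu pu okX posX hu} => // m _; rewrite wallS /= ltnn.
Qed.

(** * Forgetting strands *)

Definition swap (i k : nat) : nat :=
  if k == i then i.+1 else if k == i.+1 then i else k.

Definition rank (p : pred nat) (i : nat) : nat := count p (iota 1 i).

(* [p] marks the positions of the strands that are kept; the kept strands are renumbered by
   [rank p], and [track] gives the marked positions at the end of the braid.  Letters that are
   not generators of B_N are dropped, since [braid_eq N] may relate words containing them. *)
Fixpoint restrict (N : nat) (p : pred nat) (u : bword) : bword :=
  if u is l :: u' then
    if 0 < l.1 < N then
      nseq (p l.1 && p l.1.+1) (rank p l.1, l.2) ++
      restrict N (p \o swap l.1) u'
    else restrict N p u'
  else [::].

Fixpoint track (N : nat) (p : pred nat) (u : bword) : pred nat :=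
  if u is l :: u' then
    track N (if 0 < l.1 < N then p \o swap l.1 else p) u'
  else p.

Lemma rankS p i : rank p i.+1 = rank p i + p i.+1.
Proof. by rewrite /rank -(addn1 i) iotaD count_cat /= addn0 add1n addn1. Qed.

Lemma eq_rank p q i : p =1 q -> rank p i = rank q i.
Proof. by move=> e; apply: eq_count. Qed.

Lemma rank_swap p i :
  rank (p \o swap i.+1) i.+1 = rank p i + p i.+2.
Proof.
rewrite rankS /= /swap eqxx; congr (_ + _).
apply: eq_in_count => k; rewrite mem_iota /= => hk.
by congr p; decide_eqs.
Qed.

(** Exchanging two neighbouring positions affects only the initial segment that ends between
    them. *)
Lemma rank_swap_neq p i k : 0 < i -> k != i -> rank (p \o swap i) k = rank p k.
Proof.
case: i => // i _ nki; case: (ltnP k i.+1) => [lki|].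
  apply: eq_in_count => x; rewrite mem_iota /= => hx.
  by congr p; rewrite /swap; decide_eqs.
rewrite leq_eqVlt eq_sym (negPf nki) /=; elim: k {nki} => // k IH.
rewrite ltnS leq_eqVlt => /orP[/eqP <-|lik].
  by rewrite rankS rank_swap !rankS /= /swap; decide_eqs; rewrite addnAC.
by rewrite !rankS IH //=; congr (_ + p _); rewrite /swap; decide_eqs.
Qed.

Lemma eq_comp_swap (p q : pred nat) i : p =1 q -> p \o swap i =1 q \o swap i.
Proof. by move=> e k /=. Qed.

Lemma eq_restrict N p q u : p =1 q -> restrict N p u = restrict N q u.
Proof.
elim: u p q => //= l u IH p q e; case: ifP => _; last exact: IH.
by rewrite !e (eq_rank _ e) (IH _ (q \o swap l.1)) //; apply: eq_comp_swap.
Qed.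

Lemma eq_track N p q u : p =1 q -> track N p u =1 track N q u.
Proof.
by elim: u p q => //= l u IH p q e; apply: IH; case: ifP => // _ k /=.
Qed.

Lemma restrict_cat N p u v :
  restrict N p (u ++ v) = restrict N p u ++ restrict N (track N p u) v.
Proof.
elim: u p => //= l u IH p; case: ifP => _; rewrite IH //.
by rewrite catA.
Qed.

Lemma track_cat N p u v : track N p (u ++ v) = track N (track N p u) v.
Proof. by elim: u p => //= l u IH p; rewrite IH. Qed.

Lemma rank_track N p u : rank (track N p u) N = rank p N.
Proof.
elim: u p => //= l u IH p; rewrite IH; case: ifP => // /andP[l0 lN].
by rewrite rank_swap_neq // neq_ltn lN orbT.
Qed.

Lemma leq_rank p i k : i <= k -> rank p i <= rank p k.
Proof.
by move=> ik; rewrite -(subnKC ik) /rank iotaD count_cat leq_addr.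
Qed.

(** Each relation is checked for every choice of kept strands: if all are kept it becomes the same
    relation on new indices, otherwise both sides give the same word or a trivial identity. *)
Lemma braid_eq_restrict N u v p : braid_eq N u v ->
  track N p u =1 track N p v /\
  braid_eq (rank p N) (restrict N p u) (restrict N p v).
Proof.
move=> e; elim: e p => {u v}.
- by move=> w p; split=> //; apply: beq_refl.
- by move=> u v _ IH p; have [t r] := IH p; split; [move=> k | apply: beq_sym].
- move=> u v w _ IH1 _ IH2 p; have [t1 r1] := IH1 p; have [t2 r2] := IH2 p.
  by split; [move=> k; rewrite t1 | apply: beq_trans r2].
- move=> u u' v v' _ IH1 _ IH2 p; have [t1 r1] := IH1 p.
  have [t2 r2] := IH2 (track N p u); rewrite rank_track in r2.
  split; first by move=> k; rewrite !track_cat t2; apply: eq_track.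
  rewrite !restrict_cat -(eq_restrict _ _ t1).
  exact: beq_cat.
- move=> [|i] // b _ iN p; have swapK : p \o swap i.+1 \o swap i.+1 =1 p.
    move=> k /=; congr p; rewrite /swap.
    have [ek|nk0] := eqVneq k i.+1; first by subst k; decide_eqs.
    have [ek|nk1] := eqVneq k i.+2; first by subst k; decide_eqs.
    by decide_eqs.
  split; rewrite /= iN //= cats0 /= rank_swap {1 2}/swap; decide_eqs.
  rewrite rankS; case p1: (p i.+1); case p2: (p i.+2); try exact: beq_refl.
  rewrite /=; apply: beq_cancel; first by rewrite addn1.
  have := leq_rank p iN; rewrite !rankS p1 p2; lia.
- move=> [|i] // [|j] // _ lij jN p; have iN : i.+1 < N by lia.
  split.
    move=> k; rewrite /= iN jN /=; congr p; rewrite /swap.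
    have [ek|nk0] := eqVneq k i.+1; first by subst k; decide_eqs.
    have [ek|nk1] := eqVneq k i.+2; first by subst k; decide_eqs.
    have [ek|nk2] := eqVneq k j.+1; first by subst k; decide_eqs.
    have [ek|nk3] := eqVneq k j.+2; first by subst k; decide_eqs.
    by decide_eqs.
  rewrite /= iN jN /= !cats0 /= !rank_swap_neq; [|lia..].
  have -> : swap i.+1 j.+1 = j.+1 by rewrite /swap; decide_eqs.
  have -> : swap i.+1 j.+2 = j.+2 by rewrite /swap; decide_eqs.
  have -> : swap j.+1 i.+1 = i.+1 by rewrite /swap; decide_eqs.
  have -> : swap j.+1 i.+2 = i.+2 by rewrite /swap; decide_eqs.
  case p1: (p i.+1); case p2: (p i.+2); case p3: (p j.+1); case p4: (p j.+2);
    try exact: beq_refl.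
  (* The kept position [i.+2] lies strictly between [i.+1] and [j.+1], so the new indices still
     differ by at least two. *)
  apply: beq_comm; first by rewrite rankS p1 addn1.
    have := @leq_rank p i.+2 j lij; rewrite !rankS p1 p2 p3; lia.
  by have := leq_rank p jN; rewrite !rankS p3 p4; lia.
- move=> [|i] // _ iN p; have iN' : i.+1 < N by lia.
  split.
    move=> k; rewrite /= iN iN' /=; congr p; rewrite /swap.
    have [ek|nk0] := eqVneq k i.+1; first by subst k; decide_eqs.
    have [ek|nk1] := eqVneq k i.+2; first by subst k; decide_eqs.
    have [ek|nk2] := eqVneq k i.+3; first by subst k; decide_eqs.
    by decide_eqs.
  rewrite /= iN iN' /= !cats0 /=.
  have r1 q : rank (q \o swap i.+1) i = rank q i by rewrite rank_swap_neq //; lia.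
  have r2 q : rank (q \o swap i.+2) i = rank q i by rewrite rank_swap_neq //; lia.
  rewrite !(rank_swap, rankS, r1, r2) /= /swap; decide_eqs.
  have := leq_rank p iN; rewrite !rankS.
  case: (p i.+1); case: (p i.+2); case: (p i.+3) => /= rN;
    rewrite ?addn0 ?addn1 ?addn2; try exact: beq_refl.
  apply: beq_braid => //; lia.
Qed.

Lemma rank_leq m i : rank (fun k => k <= m) i = minn m i.
Proof.
elim: i => [|i IH]; first by rewrite minn0.
by rewrite rankS IH; case: (ltnP i m) => /= ?; lia.
Qed.

Lemma rank_gtn m i : rank (fun k => m < k) i = i - m.
Proof. by elim: i => // i IH; rewrite rankS IH; case: ltnP => /= ?; lia. Qed.

(** A letter other than sigma_m preserves the set of the first [m] positions, so the marking never
    changes and the surviving letters keep their index. *)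
Lemma restrict_leq N m u :
  all (fun l : nat * bool => [&& 0 < l.1, l.1 < N & l.1 != m]) u ->
  restrict N (fun k => k <= m) u = [seq l <- u | l.1 < m].
Proof.
elim: u => //= -[i b] u IH /andP[/= /and3P[i0 iN im]] /IH {}IH.
rewrite i0 iN /= rank_leq (@eq_restrict _ _ (fun k => k <= m)); last first.
  by move=> k; rewrite /= /swap; do ![case: eqP => ?]; lia.
rewrite IH; case: (ltnP i m) => lim; last by rewrite andbF.
by rewrite (ltnW lim).
Qed.

Lemma restrict_gtn N m u :
  all (fun l : nat * bool => [&& 0 < l.1, l.1 < N & l.1 != m]) u ->
  restrict N (fun k => m < k) u = [seq (l.1 - m, l.2) | l <- u & m < l.1].
Proof.
elim: u => //= -[i b] u IH /andP[/= /and3P[i0 iN im]] /IH {}IH.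
rewrite i0 iN /= rank_gtn (@eq_restrict _ _ (fun k => m < k)); last first.
  by move=> k; rewrite /= /swap; do ![case: eqP => ?]; lia.
by rewrite IH; case: (ltnP m i) => //= lim; rewrite leqW.
Qed.

(** * Inclusion and shift of braid groups; sorting bands by side *)

Lemma braid_eq_widen m N u v : m <= N -> braid_eq m u v -> braid_eq N u v.
Proof.
move=> mN; elim=> {u v}.
- exact: beq_refl.
- by move=> u v _; apply: beq_sym.
- by move=> u v w _ h1 _ h2; apply: beq_trans h1 h2.
- by move=> u u' v v' _ h1 _ h2; apply: beq_cat.
- by move=> i b i0 im; apply: beq_cancel => //; apply: leq_trans mN.
- by move=> i j i0 ij jm; apply: beq_comm => //; apply: leq_trans mN.
- by move=> i i0 im; apply: beq_braid => //; apply: leq_trans mN.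
Qed.

Lemma braid_eq_shift m n u v :
  braid_eq n u v -> braid_eq (m + n) (shift_word m u) (shift_word m v).
Proof.
elim=> {u v}.
- by move=> w; apply: beq_refl.
- by move=> u v _; apply: beq_sym.
- by move=> u v w _ h1 _ h2; apply: beq_trans h1 h2.
- by move=> u u' v v' _ h1 _ h2; rewrite /shift_word !map_cat; apply: beq_cat.
- by move=> i b i0 im; rewrite /shift_word /=; apply: beq_cancel; lia.
- by move=> i j i0 ij jm; rewrite /shift_word /=; apply: beq_comm; lia.
- by move=> i i0 im; rewrite /shift_word /= addnS; apply: beq_braid; lia.
Qed.

Lemma shift_wordK m w : [seq (l.1 - m, l.2) | l <- shift_word m w] = w.
Proof.
by rewrite /shift_word -map_comp map_id_in // => -[i b] _ /=; rewrite addKn.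
Qed.

Lemma shift_band_word m j k :
  shift_word m (band_word j k) = band_word (m + j) (m + k).
Proof.
have tau : shift_word m (tau_word k j) = tau_word (m + k) (m + j).
  by rewrite /shift_word /tau_word -addnS subnDl iotaDl -map_rev -!map_comp.
by rewrite /band_word -tau /shift_word map_cat /= /inv_word map_rev -!map_comp.
Qed.

Lemma filter_flatten_bands (a : pred (nat * bool)) (c : pred (nat * nat)) bs :
  {in bs, forall p, {in band_word p.1 p.2, forall l, a l = c p}} ->
  [seq l <- flatten [seq band_word p.1 p.2 | p <- bs] | a l] =
  flatten [seq band_word p.1 p.2 | p <- bs & c p].
Proof.
elim: bs => //= p bs IH h; rewrite filter_cat IH; last first.
  by move=> q hq; apply: h; rewrite inE hq orbT.
rewrite (eq_in_filter (h p (mem_head _ _))).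
by case: (c p); rewrite ?filter_predT ?filter_pred0.
Qed.

Theorem theorem1p3 (m n : nat) (X1 X2 : bword) :
  valid_word m X1 -> valid_word n X2 ->
  (strongly_quasipositive (m + n) (X1 ++ shift_word m X2) <->
   strongly_quasipositive m X1 /\ strongly_quasipositive n X2).
Proof.
move=> v1 v2; split; last first.
  case=> -[bs1 [ok1 e1]] [bs2 [ok2 e2]].
  exists (bs1 ++ [seq (m + p.1, m + p.2) | p <- bs2]); split.
    rewrite all_cat all_map; apply/andP; split.
      by apply: sub_all ok1 => p; rewrite /band_ok; lia.
    by apply: sub_all ok2 => p; rewrite /= /band_ok /=; lia.
  rewrite map_cat flatten_cat; apply: beq_cat.
    by apply: braid_eq_widen e1; apply: leq_addr.
  have := braid_eq_shift m e2; rewrite /shift_word map_flatten -!map_comp.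
  by congr (braid_eq _ (flatten _) _); apply: eq_map => p; apply: shift_band_word.
case=> bs [ok e].
set X := X1 ++ _ in e.
have vX : all (fun l : nat * bool => [&& 0 < l.1, l.1 < m + n & l.1 != m]) X.
  rewrite all_cat all_map; apply/andP; split.
    by apply: sub_all v1 => l; lia.
  by apply: sub_all v2 => l /=; lia.
have nc : ~~ has (fun p => p.1 <= m <= p.2) bs.
  apply: bands_not_crossing e => //.
  by apply: sub_all vX => l /and3P[-> _ ->].
have sep (p : nat * nat) : p \in bs ->
    [&& 0 < p.1, p.1 <= p.2, p.2 < m + n & (p.2 < m) || (m < p.1)].
  by move=> pbs; have := allP ok _ pbs; have := hasPn nc _ pbs; rewrite /band_ok /=; lia.
set C := flatten _ in e.
have bandP (p : nat * nat) (l : nat * bool) :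
    p \in bs -> l \in band_word p.1 p.2 -> p.1 <= l.1 <= p.2.
  by move=> /sep /and4P[_ /all_band_word/allP h _ _]; apply: h.
(* No band crosses [m], so the product of bands avoids sigma_m just as [X] does, and forgetting
   strands amounts to filtering letters on both sides of [e]. *)
have vC : all (fun l : nat * bool => [&& 0 < l.1, l.1 < m + n & l.1 != m]) C.
  apply/allP => l /flattenP[_ /mapP[p pbs ->] lp].
  by have := sep _ pbs; have := bandP _ _ pbs lp; lia.
split.
  exists [seq p <- bs | p.2 < m]; split.
    by apply/allP => p; rewrite mem_filter /band_ok => /andP[pm /sep]; lia.
  have [_] := braid_eq_restrict (fun k => k <= m) e.
  rewrite rank_leq (minn_idPl (leq_addr _ _)) !restrict_leq //.
  rewrite (@filter_flatten_bands _ (fun p => p.2 < m)); last first.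
    by move=> p pbs l lp; have := sep _ pbs; have := bandP _ _ pbs lp; lia.
  suff -> : [seq l <- X | l.1 < m] = X1 by [].
  rewrite filter_cat (all_filterP _); last by apply: sub_all v1 => l /andP[].
  rewrite (@eq_in_filter _ _ pred0) ?filter_pred0 ?cats0 //.
  by move=> _ /mapP[l _ ->] /=; lia.
exists [seq (p.1 - m, p.2 - m) | p <- bs & m < p.1]; split.
  apply/allP => _ /mapP[p + ->]; rewrite mem_filter /band_ok /= => /andP[pm /sep]; lia.
have [_] := braid_eq_restrict (fun k => m < k) e.
rewrite rank_gtn addKn !restrict_gtn //.
rewrite (@filter_flatten_bands _ (fun p => m < p.1)); last first.
  by move=> p pbs l lp; have := sep _ pbs; have := bandP _ _ pbs lp; lia.
have -> : [seq l <- X | m < l.1] = shift_word m X2.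
  rewrite filter_cat (@eq_in_filter _ _ pred0) ?filter_pred0 /=.
    by apply/all_filterP; rewrite all_map; apply: sub_all v2 => l /=; lia.
  by move=> l /(allP v1) /andP[_ lm]; rewrite ltnNge ltnW.
rewrite shift_wordK map_flatten -!map_comp.
congr (braid_eq _ (flatten _) _); apply/eq_in_map => p; rewrite mem_filter.
case/andP=> mp /sep pP /=.
(* The bands kept here start above [m], so the truncated subtractions are undone by adding [m]. *)
rewrite -[RHS](shift_wordK m) shift_band_word !subnKC //; lia.
Qed.
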